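(* Assume the Generalized Riemann Hypothesis. For every $\varepsilon>0$ there is a constant $C_\varepsilon>0$ such that the following holds. Let $B$ be a set of $n$ complex numbers and let $B.B=\{bb' : b,b'\in B\}$. If $B.B$ contains an arithmetic progression $\{a, a+d, \ldots, a+(N-1)d\}$ of complex numbers with nonzero common difference $d$ and $N$ terms, then $N\le C_\varepsilon\, n^{1+\varepsilon}$. *)

(* Defs.v *)
From Stdlib Require Import Reals List.
From Coquelicot Require Import Coquelicot.
From mathcomp Require Import all_boot all_algebra.

Set Implicit Arguments.
Unset Strict Implicit.
Unset Printing Implicit Defensive.

Section Alg.
Local Open Scope ring_scope.

Definition Zfree_rank (O : idomainType) (d : nat) : Prop :=
  exists phi : O -> 'rV[int]_d,
    (forall x y : O, phi (x + y) = (phi x + phi y)) /\ bijective phi.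

(* O is integrally closed in its field of fractions: if a/b (b <> 0) is a root
   of a monic polynomial X^k + p_{k-1} X^{k-1} + ... + p_0 over O, i.e.
   b^k (a/b)^k + sum_{i<k} p_i a^i b^(k-i) = 0, then b divides a in O. *)
Definition integrally_closed (O : idomainType) : Prop :=
  forall (a b : O) (k : nat) (p : nat -> O),
    b != 0 ->
    (a ^+ k + \sum_(i < k) p i * a ^+ i * b ^+ (k - i)) = 0 ->
    exists c : O, a = (b * c).

(* A domain which is a free Z-module of finite rank and integrally closed is
   exactly (up to isomorphism) the ring of integers O_K of a number field K
   (K = Frac O, [K:Q] = rank). *)
Definition ring_of_integers (O : idomainType) : Prop :=
  (exists d : nat, Zfree_rank O d) /\ integrally_closed O.

Definition is_ideal (O : idomainType) (I : O -> Prop) : Prop :=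
  I 0 /\ (forall x y, I x -> I y -> I (x - y)) /\
  (forall r x, I x -> I (r * x)).

Definition ideal_index (O : idomainType) (I : O -> Prop) (m : nat) : Prop :=
  exists r : nat -> O,
    forall x : O, exists i, (i < m)%coq_nat /\ I (x - r i) /\
      forall j, (j < m)%coq_nat -> I (x - r j) -> j = i.

Definition num_ideals_of_norm (O : idomainType) (m c : nat) : Prop :=
  exists e : nat -> (O -> Prop),
    (forall i, (i < c)%coq_nat -> is_ideal (e i) /\ ideal_index (e i) m) /\
    (forall i j, (i < c)%coq_nat -> (j < c)%coq_nat -> i <> j ->
        ~ (forall x, e i x <-> e j x)) /\
    (forall I, is_ideal I -> ideal_index I m ->
        exists i, (i < c)%coq_nat /\ forall x, I x <-> e i x).

End Alg.

Local Open Scope R_scope.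

Definition cpow_neg (m : nat) (s : C) : C :=
  (Rpower (INR m) (- Re s) * cos (- Im s * ln (INR m)),
   Rpower (INR m) (- Re s) * sin (- Im s * ln (INR m))).

Definition holomorphic_off1 (f : C -> C) : Prop :=
  forall z : C, z <> RtoC 1 -> @ex_derive C_AbsRing C_NormedModule f z.

(* f is the Dedekind zeta function of O (ring of integers of a number field K),
   i.e. the meromorphic continuation to C \ {1} of
   zeta_K(s) = sum_{m >= 1} #{ideals of norm m} m^(-s)   (Re s > 1). *)
Definition dedekind_zeta (O : idomainType) (f : C -> C) : Prop :=
  holomorphic_off1 f /\
  exists a : nat -> nat,
    (forall m, (0 < m)%coq_nat -> num_ideals_of_norm O m (a m)) /\
    forall s : C, (1 < Re s) ->
      @is_series C_AbsRing C_NormedModule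
        (fun k => Cmult (RtoC (INR (a (S k)))) (cpow_neg (S k) s)) (f s).

Definition GRH : Prop :=
  forall (O : idomainType), ring_of_integers O ->
  forall f : C -> C, dedekind_zeta O f ->
  forall s : C, (0 < Re s < 1) -> f s = RtoC 0 -> Re s = (1/2).

Definition prodset_contains_AP (B : list C) (a d : C) (N : nat) : Prop :=
  forall k : nat, (k < N)%coq_nat ->
    exists b b' : C, In b B /\ In b' B /\
      Cplus a (Cmult (RtoC (INR k)) d) = Cmult b b'.

(* Main.v *)
Require Import Defs.
From Stdlib Require Import Reals ZArith Lra List Classical_Prop.
From Coquelicot Require Import Coquelicot.
From mathcomp Require Import all_boot all_order all_algebra.
From mathcomp Require Import complex Rstruct zify ring.

(* After an affine change of variable the progression consists of numbers
   [z - k], [k < N], each attached to an edge of a bipartite graph on [n + n]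
   vertices.  A set of edges carrying no nontrivial multiplicative relation of
   length [S] has [O(S n^(1 + 1/S))] elements, since two trails of length [S] with
   the same ends yield a relation.  If the whole progression has a relation,
   then [z] is algebraic of degree at most [S], with primitive minimal polynomial
   [F] dividing an integer polynomial [G] bounded by [2 N^S] on [0, N).  Norms
   turn relations between the [z - k] into relations between the integers [F k],
   so it suffices to find about [N^(1 - o(1))] of these which are independent.  Take
   a block of [k], of length [N^(1 - o(1))], away from the roots of [G]: there [|F k|]
   is at least [H^deg F] with [H] much larger than the length [m] of the block,
   while small primes contribute at most about [m!^deg F] to the product of the
   [F k], by Lagrange interpolation.  Hence many [F k] have a large prime factor,
   each of which is shared by few [k]. *)

Set Implicit Arguments.
Unset Strict Implicit.
Unset Printing Implicit Defensive.

Import Order.TTheory GRing.Theory Num.Theory.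
Local Open Scope ring_scope.

(** * Relations from short cycles *)

Definition shift_prod (K : fieldType) (N : nat) (z : K) (f : 'I_N -> nat) : K :=
  \prod_(k < N) (z - k%:R) ^+ f k.

Lemma shift_prodD (K : fieldType) (N : nat) (z : K) (f g : 'I_N -> nat) :
  shift_prod z (fun k => f k + g k)%N = shift_prod z f * shift_prod z g.
Proof.
by rewrite /shift_prod -big_split /=; apply: eq_bigr => k _; rewrite exprD.
Qed.

(** Relations are taken homogeneous, with total exponent [S] on both sides: two trails of even
    length [S] produce this shape, and it lets leading coefficients cancel when norms are taken. *)
Definition rel_free (K : fieldType) (N : nat) (A : {set 'I_N}) (z : K)
    (S : nat) : Prop :=
  forall f g : 'I_N -> nat,
    (forall k, k \notin A -> f k = 0%N /\ g k = 0%N) ->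
    (\sum_k f k = S)%N -> (\sum_k g k = S)%N ->
    shift_prod z f = shift_prod z g -> f =1 g.

Section Graph.

Local Open Scope nat_scope.

Fixpoint words (T : Type) (s : seq T) (t : nat) : seq (seq T) :=
  if t is t'.+1 then [seq x :: w | x <- s, w <- words s t'] else [:: [::]].

Lemma size_words (T : Type) (s : seq T) t : size (words s t) = size s ^ t.
Proof. by elim: t => //= t IH; rewrite size_allpairs IH expnS. Qed.

Lemma mem_words (T : eqType) (s w : seq T) :
  {subset w <= s} -> w \in words s (size w).
Proof.
elim: w => //= x w IH sub; apply/allpairsP; exists (x, w) => /=; split=> //.
  by apply: sub; rewrite mem_head.
by apply: IH => y yw; apply: sub; rewrite inE yw orbT.
Qed.

(** Words are stored last letter first, so [size w'] is the number of edges walked before [e]. For a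
    trail starting on the left, [b = false] counts the edges walked left to right and [b = true]
    those walked back. *)
Fixpoint xexp (N : nat) (b : bool) (w : seq 'I_N) (k : 'I_N) : nat :=
  if w is e :: w' then (k == e) && (odd (size w') == b) + xexp b w' k else 0.

Lemma xexp_mem (N : nat) (w : seq 'I_N) k : xexp false w k + xexp true w k = count_mem k w.
Proof.
elim: w => //= e w IH; rewrite -IH eq_sym.
case: (e == k) => //=; case: (odd _) => /=; lia.
Qed.

Lemma xexp_sum (N : nat) (w : seq 'I_N) :
  \sum_(k < N) xexp false w k = uphalf (size w) /\ \sum_(k < N) xexp true w k = (size w)./2.
Proof.
elim: w => [|e w [IH1 IH2]] /=; first by rewrite !big1.
rewrite !big_split /= IH1 IH2.
have E b : \sum_(k < N) (k == e) && b = b :> nat.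
  rewrite (bigD1 e) //= eqxx /= big1 ?addn0 // => k /negbTE -> //.
rewrite !E uphalfE /=; have := odd_double_half (size w).
by rewrite uphalf_half; case: (odd _) => /=; lia.
Qed.

Variables (n N : nat) (l r : 'I_N -> 'I_n).

Definition endpt (b : bool) (e : 'I_N) : bool * 'I_n :=
  (b, if b then r e else l e).

Definition inner (A : {set 'I_N}) (W : {set bool * 'I_n}) : {set 'I_N} :=
  [set e in A | (endpt false e \in W) && (endpt true e \in W)].

(* [W] maximises the number of inner edges plus [d] times the number of
   missing vertices, so deleting a vertex of [W] loses at least [d] edges. *)
Lemma min_degree_core (A : {set 'I_N}) d : n.*2 * d < #|A| ->
  exists W : {set bool * 'I_n}, inner A W != set0 /\
    forall v, v \in W -> d <= #|[set e in inner A W | endpt v.1 e == v]|.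
Proof.
move=> big.
pose Phi (W : {set bool * 'I_n}) := #|inner A W| + d * #|~: W|.
have innerT : inner A setT = A by apply/setP=> e; rewrite !inE !andbT.
have [W _ maxW] := @arg_maxnP {set bool * 'I_n} setT xpredT Phi isT.
exists W; split.
  apply/eqP=> W0; have := maxW setT isT.
  rewrite /Phi innerT W0 cards0 add0n setCT cards0 muln0 addn0.
  have : #|~: W| <= n.*2.
    by rewrite (leq_trans (max_card _)) // card_prod card_bool card_ord mul2n.
  move=> /(leq_mul (leqnn d)); rewrite [d * n.*2]mulnC => h1 h2.
  by move: (leq_trans big (leq_trans h2 h1)); rewrite ltnn.
move=> v vW; have := maxW (W :\ v) isT; rewrite /Phi.
have -> : #|~: (W :\ v)| = #|~: W|.+1.
  by rewrite setCD setUC cardsU1 inE vW.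
have : #|inner A W| <=
    #|inner A (W :\ v)| + #|[set e in inner A W | endpt v.1 e == v]|.
  rewrite -cardsUI (leq_trans _ (leq_addr _ _)) // subset_leq_card //.
  apply/subsetP=> e; rewrite !inE => /and3P [-> -> ->] /=; rewrite !andbT.
  case: v {vW} => [[] v] /=; case: eqP => //= ne.
rewrite mulnS; lia.
Qed.

Variables (A : {set 'I_N}) (W : {set bool * 'I_n}) (u : 'I_n).

(* A trail is stored with its last edge first; it starts at the left vertex [u],
   so its edges are traversed alternately left to right and right to left. *)
Definition curpt (w : seq 'I_N) : bool * 'I_n :=
  if w is e :: w' then endpt (~~ odd (size w')) e else (false, u).

Definition ext (w : seq 'I_N) : seq 'I_N :=
  [seq e <- enum (inner A W) |
     (endpt (odd (size w)) e == curpt w) && (e \notin w)].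

Fixpoint trails (t : nat) : seq (seq 'I_N) :=
  if t is t'.+1 then [seq e :: w | w <- trails t', e <- ext w] else [:: [::]].

Lemma trailsP t w : w \in trails t.+1 ->
  exists e w', [/\ w = e :: w', w' \in trails t & e \in ext w'].
Proof.
by case/allpairsPdep=> w' [e [w't ew ->]]; exists e, w'.
Qed.

Lemma ext_mem e w : e \in ext w ->
  [/\ e \in inner A W, endpt (odd (size w)) e = curpt w & e \notin w].
Proof. by rewrite mem_filter mem_enum => /andP [/andP [/eqP ? ?] ?]. Qed.

Lemma trails_uniq t : uniq (trails t).
Proof.
elim: t => //= t IH; apply: allpairs_uniq_dep => //.
  by move=> w _; rewrite filter_uniq // enum_uniq.
by move=> [w e] [w' e'] _ _ [] /= -> ->.
Qed.

Lemma trail_props t w : w \in trails t ->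
  [/\ size w = t, uniq w & {subset w <= inner A W}].
Proof.
elim: t w => [|t IH] w; first by rewrite inE => /eqP ->.
case/trailsP=> e [w' [-> /IH [sz un sub] /ext_mem [eA _ ew']]].
split=> /=; rewrite ?sz ?ew' //.
by move=> k; rewrite inE => /orP [/eqP ->|/sub].
Qed.

Hypothesis uW : (false, u) \in W.

Lemma curpt_mem t w : w \in trails t -> curpt w \in W.
Proof.
case: t => [|t]; first by rewrite inE => /eqP ->.
case/trailsP=> e [w' [-> _ /ext_mem [+ _ _]]] /=.
by rewrite inE => /and3P [_ ? ?]; case: (odd _).
Qed.

Lemma curpt_side w : (curpt w).1 = odd (size w).
Proof. by case: w. Qed.

Variable d : nat.
Hypothesis mindeg : forall v, v \in W ->
  d <= #|[set e in inner A W | endpt v.1 e == v]|.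

(** At least [d] inner edges meet the current endpoint, and at most [t] of them have been used. *)
Lemma size_ext t w : w \in trails t -> d - t <= size (ext w).
Proof.
move=> wt; have [sz un sub] := trail_props wt.
have := mindeg (curpt_mem wt); rewrite curpt_side => h.
rewrite leq_subLR; apply: leq_trans h _.
rewrite cardE -sz -size_cat; apply: uniq_leq_size; first exact: enum_uniq.
move=> e; rewrite mem_enum !inE mem_cat mem_filter mem_enum !inE.
by case: (e \in w) => //= /andP [-> ->].
Qed.

Lemma size_trails S t : t <= S -> (d - S) ^ t <= size (trails t).
Proof.
elim: t => // t IH tS.
rewrite /= size_allpairs_dep expnS mulnC.
apply: leq_trans (_ : size (trails t) * (d - S) <= _).
  by rewrite leq_mul2r IH ?orbT // ltnW.
rewrite sumnE big_map big_seq -sum1_size big_distrl /= big_seq.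
apply: leq_sum => w wt; rewrite mul1n; apply: leq_trans (size_ext wt).
by rewrite leq_sub2l // ltnW.
Qed.

Variables (K : fieldType) (z : K) (bl br : 'I_n -> K).
Hypothesis edgeE : forall k, k \in A -> (bl (l k) * br (r k) = z - (k : nat)%:R)%R.

Lemma shift_prod_cons b (e : 'I_N) w :
  (shift_prod z (xexp b (e :: w)) =
   (if odd (size w) == b then z - (e : nat)%:R else 1) * shift_prod z (xexp b w))%R.
Proof.
rewrite /shift_prod /=; under eq_bigr do rewrite exprD.
rewrite big_split /=; congr (_ * _)%R.
case: (_ == b); last by rewrite big1 // => k _; rewrite andbF.
rewrite (bigD1 e) //= eqxx /= expr1 big1 ?mulr1 // => k /negbTE -> //.
Qed.

Lemma trail_relation t w : w \in trails t ->
  (if odd t then bl u * br (curpt w).2 * shift_prod z (xexp true w)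
     = shift_prod z (xexp false w)
   else bl u * shift_prod z (xexp true w)
     = bl (curpt w).2 * shift_prod z (xexp false w))%R.
Proof.
elim: t w => [|t IH] w; first by rewrite inE => /eqP ->.
case/trailsP=> e [w' [-> w't /ext_mem [eA ec _]]].
have [sz _ _] := trail_props w't.
have {}eA : e \in A by move: eA; rewrite inE => /andP [].
have := IH _ w't; rewrite !shift_prod_cons /= sz.
have E := edgeE eA; have := ec; rewrite sz => <-.
case: (odd t) => /= IHt; rewrite mul1r -E.
  by rewrite -[in RHS]IHt; ring.
by rewrite mulrAC IHt mulrAC.
Qed.

End Graph.

(* Two trails of length [S] with the same endpoints give a relation, which is
   trivial only if they use the same edges; hence there are at most [n * S ^ S]
   trails, whereas a minimum degree [d] yields at least [(d - S) ^ S]. *)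
Lemma rel_free_min_degree (K : fieldType) (n N : nat) (l r : 'I_N -> 'I_n)
    (z : K) (bl br : 'I_n -> K) (A : {set 'I_N}) (S d : nat) :
  (forall k, k \in A -> bl (l k) * br (r k) = z - (k : nat)%:R) ->
  (forall k, k \in A -> z != (k : nat)%:R) ->
  ~~ odd S -> rel_free A z S -> (n.*2 * d < #|A|)%N ->
  ((d - S) ^ S <= n * S ^ S)%N.
Proof.
move=> edgeE znz evS free big.
have [W [/set0Pn [e0 e0W] mindeg]] := min_degree_core l r big.
pose u := l e0.
have uW : (false, u) \in W by move: e0W; rewrite inE => /and3P [].
have innerA k : k \in inner l r A W -> k \in A by rewrite inE => /andP [].
have ednz k : k \in A -> (bl (l k) != 0) && (br (r k) != 0).
  by move=> kA; rewrite -negb_or -mulf_eq0 edgeE // subr_eq0 znz.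
have blu : bl u != 0 by have /andP [] := ednz _ (innerA _ e0W).
pose ts := trails l r A W u S.
apply: leq_trans (size_trails uW mindeg (leqnn S)) _.
rewrite -/ts -sum1_size.
rewrite (partition_big (fun w => (curpt l r u w).2) xpredT) //=.
rewrite -[X in (X * _)%N](card_ord n) -sum_nat_const; apply: leq_sum => v _.
rewrite sum1_count -size_filter.
set tv := [seq w <- ts | _].
have [-> // | [w0 w0v]] : tv = [::] \/ exists w0, w0 \in tv.
  by case: tv => [|w0 tv]; [left | right; exists w0; rewrite mem_head].
have tvP w : w \in tv -> w \in ts /\ curpt l r u w = (false, v).
  rewrite mem_filter => /andP [/eqP <- wt]; split=> //.
  have [sz _ _] := trail_props wt.
  by move: (curpt_side l r u w); rewrite sz (negbTE evS); case: (curpt _ _ _ _) => ? ? /= ->.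
have [w0t c0] := tvP _ w0v.
have [sz0 un0 sub0] := trail_props w0t.
(* It is enough that every trail ending at [v] uses only edges of [w0]: it is then a word of length
   [S] over [w0]. *)
rewrite -{1}sz0 -size_words; apply: uniq_leq_size.
  exact: filter_uniq (trails_uniq _ _ _ _ _ _).
move=> w wv; have [wt cw] := tvP _ wv.
have [sz un sub] := trail_props wt.
rewrite -sz; apply: mem_words => k kw.
have R1 := trail_relation edgeE w0t; have R2 := trail_relation edgeE wt.
move: R1 R2; rewrite (negbTE evS) c0 cw /= => R1 R2.
have blv : bl v != 0.
  case: (w) wt cw => [|e w1] wt ce;
    move/(congr1 fst): (ce) => /=; move/(congr1 snd): ce => /= <- //.
  case: (odd _) => //= _.
  have [_ _ sub1] := trail_props wt.
  by have /andP [] := ednz _ (innerA _ (sub1 e (mem_head _ _))).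
(* Cross-multiplying the relations of the two trails and cancelling [bl u * bl v] relates these
   exponents. Trails repeat no edge, so an edge of [w] outside [w0] would add 1 to exactly one of
   [f] and [g]. *)
pose f k := (xexp false w k + xexp true w0 k)%N.
pose g k := (xexp false w0 k + xexp true w k)%N.
have fg : f =1 g.
  have [sf sg] := xexp_sum w; have [sf0 sg0] := xexp_sum w0.
  have hS : (uphalf S + S./2)%N = S.
    by rewrite uphalf_half (negbTE evS) add0n addnn even_halfK.
  have out j x : {subset x <= inner l r A W} -> j \notin A ->
      xexp false x j = 0%N /\ xexp true x j = 0%N.
    move=> subx jA; have := xexp_mem x j; rewrite (count_memPn _) => [|].
      by move/eqP; rewrite addn_eq0 => /andP [/eqP -> /eqP ->].
    by apply: contra jA => /subx /innerA.
  apply: free.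
  - by move=> j jA; rewrite /f /g; have [-> ->] := out j w sub jA;
       have [-> ->] := out j w0 sub0 jA.
  - by rewrite big_split /= sf sg0 sz sz0.
  - by rewrite big_split /= sf0 sg sz sz0.
  - rewrite /f /g !shift_prodD; apply: (mulfI (mulf_neq0 blu blv)).
    move: R1 R2; set P1 := shift_prod z _; set P2 := shift_prod z _ => R1.
    set P3 := shift_prod z _; set P4 := shift_prod z _ => R2.
    transitivity ((bl v * P4) * (bl u * P1)); first by ring.
    by rewrite -R2 R1; ring.
have := fg k; rewrite /f /g.
have := xexp_mem w k; have := xexp_mem w0 k.
rewrite !count_uniq_mem // kw.
move: (xexp false w k) (xexp true w k) (xexp false w0 k) (xexp true w0 k).
by case: (k \in w0) => //; clear=> *; lia.
Qed.

(** * The minimal polynomial of the base point *)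

(** Take the primitive part of an annihilator of least size. The remainder of a pseudo-division by
    it kills [z] and is smaller, hence zero; Gauss's lemma turns divisibility up to a scalar into
    divisibility over the integers. *)
Lemma min_int_poly (K : numFieldType) (z : K) (G : {poly int}) :
  G != 0 -> root (map_poly intr G) z ->
  exists F : {poly int}, [/\ zcontents F = 1, root (map_poly intr F) z &
    forall P : {poly int}, root (map_poly intr P) z -> exists Q, P = F * Q].
Proof.
have [n] := ubnP (size G); elim: n G => // n IH G ltn G0 rG.
have c0 : (zcontents G)%:~R != 0 :> K by rewrite intr_eq0 zcontents_eq0.
have rF : root (map_poly intr (zprimitive G)) z.
  move: rG; rewrite {1}[G]zpolyEprim map_polyZ /= rootE hornerZ mulf_eq0.
  by rewrite (negbTE c0).
have [[P [P0 rP ltP]] | no] := classic (exists P : {poly int},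
    [/\ P != 0, root (map_poly intr P) z & (size P < size G)%N]).
  by apply: IH rP => //; apply: leq_trans ltP _.
exists (zprimitive G); split=> // [|P rP]; first by rewrite zcontents_primitive G0.
suff /dvdpP_int [Q ->] : zprimitive G %| P by exists Q; rewrite zprimitive_id.
have F0 : zprimitive G != 0 by rewrite zprimitive_eq0.
rewrite /dvdp -[_ == 0]negbK; apply/negP=> R0; apply: no.
exists (P %% zprimitive G); split=> //.
  have := congr1 (map_poly (intr : int -> K)) (Pdiv.Idomain.divp_eq P (zprimitive G)).
  rewrite map_polyZ rmorphD rmorphM /= => /(congr1 (fun p => p.[z])).
  rewrite hornerZ hornerD hornerM (rootP rP) (rootP rF) !mulr0 add0r => /esym.
  by move/rootP.
by rewrite -[X in (_ < X)%N]size_zprimitive ltn_modp.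
Qed.

Section RelPoly.

Variables (N : nat).

Definition rel_poly (f g : 'I_N -> nat) : {poly int} :=
  \prod_(k < N) ('X - (k%:Z)%:P) ^+ f k - \prod_(k < N) ('X - (k%:Z)%:P) ^+ g k.

Lemma rel_poly_horner (K : fieldType) (f g : 'I_N -> nat) (w : K) :
  (map_poly intr (rel_poly f g)).[w] = shift_prod w f - shift_prod w g.
Proof.
have E h : (map_poly intr (\prod_(k < N) ('X - (k%:Z)%:P) ^+ h k)).[w] = shift_prod w h.
  rewrite rmorph_prod horner_prod; apply: eq_bigr => k _.
  by rewrite rmorphXn rmorphB /= map_polyX map_polyC /= horner_exp hornerXsubC.
by rewrite rmorphB hornerD hornerN !E.
Qed.

(** Where [f] and [g] differ at [k], cancel the smaller power of [X - k]: at [k] one product then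
    vanishes and the other does not. *)
Lemma rel_poly_neq0 (f g : 'I_N -> nat) : ~ f =1 g -> rel_poly f g != 0.
Proof.
move=> nfg; apply/negP; rewrite /rel_poly subr_eq0 => eq_fg; apply: nfg => k.
have lead (h1 h2 : 'I_N -> nat) : (h1 k < h2 k)%N ->
    \prod_(j < N) ('X - (j%:Z)%:P) ^+ h1 j !=
    \prod_(j < N) ('X - (j%:Z)%:P) ^+ h2 j :> {poly int}.
  move=> lt; rewrite (bigD1 k) //= [X in _ != X](bigD1 k) //=.
  rewrite -(subnKC (ltnW lt)) exprD -mulrA.
  apply/eqP => /(mulfI (expf_neq0 _ (negbT (polyXsubC_eq0 _))))
    /(congr1 (fun p => p.[k%:Z])) /eqP.
  rewrite hornerM horner_exp hornerXsubC subrr expr0n subn_eq0 leqNgt lt mul0r.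
  rewrite horner_prod prodf_seq_eq0 => /hasP [j _ /andP [jk]].
  rewrite horner_exp hornerXsubC expf_eq0 subr_eq0 eqz_nat => /andP [_ /eqP kj].
  by case/negP: jk; apply/eqP/val_inj.
case: (ltngtP (f k) (g k)) => // /lead; first by rewrite eq_fg.
by rewrite eq_sym eq_fg.
Qed.

Lemma size_rel_poly (f g : 'I_N -> nat) S :
  (\sum_k f k = S)%N -> (\sum_k g k = S)%N -> (size (rel_poly f g) <= S.+1)%N.
Proof.
have sz (h : 'I_N -> nat) : (\sum_k h k = S)%N ->
    size (\prod_(j < N) ('X - (j%:Z)%:P) ^+ h j : {poly int}) = S.+1.
  move=> <-; rewrite size_prod => [|i _]; last by rewrite expf_neq0 // polyXsubC_eq0.
  under eq_bigr do rewrite size_exp_XsubC -addn1.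
  by rewrite big_split /= sum1_card subSn ?leq_addl // addnK.
move=> Sf Sg; rewrite (leq_trans (size_polyD _ _)) // size_polyN.
by rewrite !sz // maxnn.
Qed.

Lemma rel_poly_bound (f g : 'I_N -> nat) S (x : nat) :
  (\sum_k f k = S)%N -> (\sum_k g k = S)%N -> (x < N)%N ->
  (`|(rel_poly f g).[x%:Z]|%N <= 2 * N ^ S)%N.
Proof.
move=> Sf Sg xN.
have bd (h : 'I_N -> nat) : (\sum_k h k = S)%N ->
    (`|(\prod_(j < N) ('X - (j%:Z)%:P) ^+ h j : {poly int}).[x%:Z]|%N <= N ^ S)%N.
  move=> <-; rewrite horner_prod expn_sum.
  elim/big_ind2: _ => // [u1 u2 v1 v2 h1 h2|k _].
    by rewrite abszM leq_mul.
  rewrite horner_exp hornerXsubC abszX; case: (h k) => // e.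
  by rewrite leq_exp2r //; have := ltn_ord k; lia.
rewrite /rel_poly hornerD hornerN mul2n -addnn.
move: (bd f Sf) (bd g Sg); move: (_.[_]) (_.[_]) => u v hu hv.
by move: hu hv; clear; lia.
Qed.

End RelPoly.

(** Pigeonhole: lay out [(size ws).+1] blocks separated by gaps of length [2 * H]. A point lies
    within [H] of at most one of them. *)
Lemma block_avoiding (K : numDomainType) (ws : seq K) (m H N : nat) :
  ((size ws).+1 * (m + H.*2) <= N)%N ->
  exists2 a, (a + m <= N)%N &
    forall k : nat, (a <= k < a + m)%N -> forall w, w \in ws -> (H%:R <= `|k%:R - w|)%R.
Proof.
move=> big; pose st i := (i * (m + H.*2))%N.
pose near (i : nat) := [pred w : K | has (fun k => ~~ (H%:R <= `|k%:R - w|)) (iota (st i) m)].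
have [/existsP [i good]|/existsPn bad] :=
    boolP [exists i : 'I_(size ws).+1, all (predC (near i)) ws].
  exists (st i).
    apply: leq_trans big; apply: leq_trans (_ : i.+1 * (m + H.*2) <= _)%N.
      by rewrite mulSn [X in (_ <= X)%N]addnC leq_add2l leq_addr.
    by rewrite leq_mul2r ltn_ord orbT.
  move=> k kI w wws; have /allP /(_ w wws) /= := good.
  by rewrite -all_predC => /allP /(_ k); rewrite mem_iota kI /= negbK; apply.
have badw (i : 'I_(size ws).+1) : exists j : 'I_(size ws), near i (tnth (in_tuple ws) j).
  have := bad i; rewrite -has_predC => /hasP [w wws /=]; rewrite negbK => nw.
  by have /tnthP [j ej] : w \in in_tuple ws by []; exists j; rewrite -ej.
have [c cP] := fin_all_exists badw.
suff c_inj : injective c by have := leq_card c c_inj; rewrite !card_ord ltnn.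
have far (i i' : 'I_(size ws).+1) : (i < i')%N -> c i <> c i'.
  move=> ii' cc; have := cP i'; rewrite -cc; have := cP i; move: (tnth _ _) => w /=.
  case/hasP=> k; rewrite mem_iota => /andP [_ kI] nk.
  case/hasP=> k'; rewrite mem_iota => /andP [k'I _] nk'.
  have gap : (k + H.*2 <= k')%N.
    apply: leq_trans k'I; apply: leq_trans (_ : i.+1 * (m + H.*2) <= _)%N.
      by rewrite mulSn -/(st i); move: kI; clear; lia.
    by rewrite leq_mul2r ii' orbT.
  move: nk nk'; rewrite -!real_ltNge ?realE ?ler0n ?normr_ge0 // => nk nk'.
  have := ltrD nk' nk; rewrite -[X in _ + X]normrN => /(le_lt_trans (ler_normD _ _)).
  rewrite opprB addrA subrK -natrB ?(leq_trans _ gap) ?leq_addr //.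
  by rewrite normr_nat -natrD ltr_nat addnn; lia.
move=> i i' cc; case: (ltngtP (i : nat) (i' : nat)) => [lt|lt|].
- by case: (far _ _ lt cc).
- by case: (far _ _ lt (esym cc)).
exact: ord_inj.
Qed.

(** * Small primes and Lagrange interpolation *)

(** The value at 0 is 0, not infinity, so the diagonal terms in sums of valuations of differences
    vanish. *)
Definition val_int (p : nat) (x : int) : nat := logn p `|x|%N.

Lemma val_int_prod (p : nat) (I : eqType) (s : seq I) (P : pred I) (E : I -> int) :
  (forall i, i \in s -> P i -> E i != 0) ->
  val_int p (\prod_(i <- s | P i) E i) = (\sum_(i <- s | P i) val_int p (E i))%N.
Proof.
elim: s => [|x s IH] nz; first by rewrite !big_nil /val_int logn1.
rewrite !big_cons; have {}IH := IH (fun i h => nz i (mem_behead (s := x :: s) h)).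
case: ifP => // Px; rewrite /val_int abszM lognM.
- by rewrite -!/(val_int _ _) IH.
- by rewrite absz_gt0 nz ?mem_head.
rewrite absz_gt0 prodf_seq_neq0; apply/allP => i si; apply/implyP => Pi.
by apply: nz; rewrite ?inE ?si ?orbT.
Qed.

(** Otherwise every coefficient [F.[kap i] / pi i] of Lagrange's formula would be divisible by [p]
    in the localisation at [p], hence [F] too, against its being primitive. *)
Lemma interpolation_val (p : nat) (T : finType) (A : {set T}) (kap : T -> int)
    (F : {poly int}) :
  prime p -> {in A &, injective kap} -> zcontents F = 1 -> (size F <= #|A|)%N ->
  exists2 i, i \in A &
    (val_int p F.[kap i] <= \sum_(j in A) val_int p (kap i - kap j)%R)%N.
Proof.
move=> pr_p inj cF szF.
have [/existsP [i /andP [iA h]] | /existsPn no] := boolP [exists i : T, (i \in A) &&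
    (val_int p F.[kap i] <= \sum_(j in A) val_int p (kap i - kap j)%R)%N].
  by exists i.
exfalso.
pose pi i := \prod_(j in A | j != i) (kap i - kap j).
have pinz i : i \in A -> pi i != 0.
  move=> iA; apply/prodf_neq0 => j /andP [jA ji].
  by rewrite subr_eq0; apply: contra ji => /eqP /inj -> //.
have valpi i : i \in A ->
    val_int p (pi i) = (\sum_(j in A) val_int p (kap i - kap j)%R)%N.
  move=> iA; rewrite [RHS](bigD1 i) //= subrr {2}/val_int /= logn0 add0n.
  rewrite /pi val_int_prod // => j _ /andP [jA ji].
  by rewrite subr_eq0; apply: contra ji => /eqP /inj -> //.
have dec i : exists ab : int * int, i \in A ->
    ~~ (p %| `|ab.2|)%N /\ ab.2 * F.[kap i] = p%:Z * ab.1 * pi i.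
  case: (boolP (i \in A)) => [iA | _]; last by exists (0, 0).
  have := no i; rewrite iA /= -ltnNge -valpi // => lt.
  have Fnz : F.[kap i] != 0 by apply: contraTneq lt => ->; rewrite /val_int logn0.
  set v := val_int p (pi i) in lt.
  have d1 : (p%:Z ^+ v.+1 %| F.[kap i])%Z.
    by rewrite dvdzE abszX /= pfactor_dvdn // absz_gt0.
  have d2 : (p%:Z ^+ v %| pi i)%Z.
    by rewrite dvdzE abszX /= pfactor_dvdn // absz_gt0 pinz.
  have pv0 : p%:Z ^+ v != 0 by rewrite expf_neq0 // -lt0n prime_gt0.
  have [a Ea] := dvdzP d1; have [b Eb] := dvdzP d2.
  exists (a, b) => _ /=; split.
    apply/negP=> pb; suff: (v < v)%N by rewrite ltnn.
    rewrite {2}/v /val_int -pfactor_dvdn //; last by rewrite absz_gt0 pinz.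
    by rewrite Eb abszM abszX expnS dvdn_mul.
  by rewrite Ea Eb exprS; ring.
have [ab abP] := fin_all_exists dec.
pose a i := (ab i).1; pose b i := (ab i).2.
pose c i := \prod_(j in A | j != i) b j.
pose L i := \prod_(j in A | j != i) ('X - (kap j)%:P).
pose Q := \sum_(i in A) (c i * a i) *: L i.
(* Lagrange's formula with the denominators [b i], prime to [p], cleared: both sides agree at [#|A|]
   points and have size at most [#|A|]. *)
have EQ : (\prod_(i in A) b i) *: F = p%:Z *: Q.
  apply/eqP; rewrite -subr_eq0; apply/eqP.
  apply: (@roots_geq_poly_eq0 _ _ [seq kap i | i <- enum A]).
  - apply/allP => _ /mapP [i + ->]; rewrite mem_enum => iA.
    rewrite rootE hornerD hornerN !hornerZ horner_sum [X in _ - _ * X](bigD1 i) //=.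
    rewrite [X in _ - _ * (_ + X)]big1 => [|j /andP [jA ji]]; last first.
      rewrite hornerZ horner_prod (bigD1 i) /= ?iA 1?eq_sym //.
      by rewrite hornerXsubC subrr mul0r mulr0.
    rewrite addr0 hornerZ; have -> : (L i).[kap i] = pi i.
      by rewrite horner_prod; apply: eq_bigr => j _; rewrite hornerXsubC.
    rewrite (bigD1 i) //= -/(c i) mulrAC (proj2 (abP i iA)) -/(a i).
    by apply/eqP; ring.
  - rewrite map_inj_in_uniq ?enum_uniq // => x y.
    by rewrite !mem_enum; apply: inj.
  rewrite size_map -cardE (leq_trans (size_polyD _ _)) // geq_max.
  rewrite (leq_trans (size_scale_leq _ _)) //= size_polyN.
  apply: leq_trans (size_scale_leq _ _) _.
  apply: leq_trans (size_sum _ _ _) _; apply/bigmax_leqP => i iA.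
  apply: leq_trans (size_scale_leq _ _) _.
  rewrite /L -big_filter size_prod_XsubC.
  by rewrite -sum1_size big_filter -[#|A|]sum1_card [X in (_ <= X)%N](bigD1 i).
have : (p %| `|zcontents ((\prod_(i in A) b i) *: F)|)%N.
  by rewrite EQ zcontentsZ abszM dvdn_mulr.
rewrite zcontentsZ cF mulr1.
elim/big_ind: _ => [|x y IHx IHy|i iA].
- by rewrite dvdn1; case: eqP pr_p => // ->.
- by rewrite abszM Euclid_dvdM // => /orP [].
by have [/negbTE -> _] := abP i iA.
Qed.

(** An extremal choice of [E], in the manner of Fekete points. Interpolation on [k |: E] gives some
    [i] with a good bound. If [i] is not [k], then exchanging [i] for [k] cannot increase [Psi],
    which carries the bound over to [k]. *)
Lemma exceptional_val (p : nat) (T : finType) (kap : T -> int) (F : {poly int}) D :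
  prime p -> injective kap -> zcontents F = 1 -> (size F <= D.+1)%N -> (D <= #|T|)%N ->
  exists2 E : {set T}, #|E| = D & forall k, k \notin E ->
    (val_int p F.[kap k] <= \sum_(t in E) val_int p (kap k - kap t)%R)%N.
Proof.
move=> pr_p inj cF szF DT.
pose v i := (val_int p F.[kap i])%:Z.
pose d i j := (val_int p (kap i - kap j))%:Z.
have dC i j : d i j = d j i by rewrite /d /val_int -abszN opprB.
have dd i : d i i = 0 by rewrite /d subrr /val_int /= logn0.
(* The double sum counts each pair twice, hence the factor 2 on [v i]. *)
pose Psi (E : {set T}) := \sum_(i in E) (v i *+ 2 - \sum_(j in E) d i j).
have [E0 /eqP E0D] : exists E0 : {set T}, #|E0| == D.
  have : (0 < #|[set E : {set T} | (E \subset [set: T]) && (#|E| == D)]|)%N.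
    by rewrite cards_draws cardsT bin_gt0.
  by case/card_gt0P=> E; rewrite inE => /andP [_ ?]; exists E.
have PsiD (E : {set T}) i : i \notin E ->
    Psi (i |: E) = Psi E + v i *+ 2 - (\sum_(j in E) d i j) *+ 2.
  move=> iE; have sumU j : \sum_(k in i |: E) d j k = d j i + \sum_(k in E) d j k.
    by rewrite big_setU1.
  rewrite /Psi big_setU1 //= sumU dd add0r.
  under eq_bigr => k kE do rewrite sumU opprD addrCA.
  rewrite big_split /= sumrN.
  have -> : \sum_(k in E) d k i = \sum_(k in E) d i k by apply: eq_bigr.
  by ring.
case: (@arg_maxP _ _ _ E0 (fun E : {set T} => #|E| == D) Psi); first exact/eqP.
move=> E /eqP ED maxE; exists E => // k kE.
have [|i] := @interpolation_val p T (k |: E) kap F pr_p (in2W inj) cF.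
  by rewrite cardsU1 kE ED.
have dsum j (P : {set T}) : (\sum_(t in P) val_int p (kap j - kap t)%R)%N%:Z
    = \sum_(t in P) d j t.
  by rewrite -natz natr_sum; apply: eq_bigr => t _; rewrite natz.
rewrite -lez_nat dsum => iA le_i; rewrite -lez_nat dsum.
move: le_i; rewrite big_setU1 //=.
have [-> | ne] := eqVneq i k; first by rewrite dd add0r.
have iE : i \in E by move: iA; rewrite !inE (negbTE ne).
have iE1 : i \notin E :\ i by rewrite !inE eqxx.
have kE1 : k \notin E :\ i by rewrite !inE (negbTE kE) andbF.
have := maxE (k |: E :\ i); rewrite cardsU1 kE1 -ED (cardsD1 i E) iE eqxx.
rewrite PsiD // => /(_ isT).
have PsiE : Psi E = Psi (E :\ i) + v i *+ 2 - (\sum_(j in E :\ i) d i j) *+ 2.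
  by rewrite -PsiD // setD1K.
have sumE j : \sum_(t in E) d j t = d j i + \sum_(t in E :\ i) d j t.
  by rewrite -big_setU1 //= setD1K.
rewrite PsiE !sumE dd (dC k i) /v !mulr2n.
move: (val_int _ _) (val_int _ _) (\sum_(j in _) d i j) (\sum_(j in _) d k j) (d i k) (Psi _).
by clear=> *; lia.
Qed.

(** The terms on either side of [k = t] add up to the valuation of [t! * (m - 1 - t)!], which
    divides [(m - 1)!]. *)
Lemma sum_val_dist (p m : nat) (t : 'I_m) (a : nat) :
  (\sum_(k < m) val_int p ((a + k)%:Z - (a + t)%:Z)%R <= logn p m`!)%N.
Proof.
have logf j : (\sum_(0 <= i < j) logn p i.+1 = logn p j`!)%N.
  elim: j => [|j IH]; first by rewrite big_geq // fact0 logn1.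
  by rewrite big_nat_recr //= IH factS lognM ?fact_gt0 // addnC.
case: t => t tm /=; rewrite -(big_mkord xpredT (fun k => val_int p ((a + k)%:Z - (a + t)%:Z))).
have {1}-> : m = (t + (m - t.+1).+1)%N by lia.
rewrite (big_cat_nat _ (n := t)) //= ?leq_addr //.
have -> : (\sum_(0 <= k < t) val_int p ((a + k)%:Z - (a + t)%:Z)%R = logn p t`!)%N.
  rewrite -logf big_nat_rev /=; apply: eq_big_nat => k kt.
  by rewrite /val_int; congr (logn p _); lia.
rewrite -[X in index_iota X _](add0n t) big_addn addKn big_nat_recl //.
have -> : (\sum_(0 <= k < m - t.+1) val_int p ((a + (k.+1 + t))%:Z - (a + t)%:Z)%R
    = logn p (m - t.+1)`!)%N.
  by rewrite -logf; apply: eq_big_nat => k kt; rewrite /val_int; congr (logn p _); lia.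
rewrite add0n subrr {1}/val_int /= logn0 add0n -lognM ?fact_gt0 //.
apply: dvdn_leq_log; first exact: fact_gt0.
have -> : (m - t.+1 = m.-1 - t)%N by lia.
have tm1 : (t <= m.-1)%N by lia.
apply: (@dvdn_trans (m.-1)`!); first by rewrite -(bin_fact tm1) dvdn_mull.
by rewrite -{2}(ltn_predK tm) factS dvdn_mull ?dvdnn.
Qed.

Lemma partn_leq (y n : nat) : (0 < n)%N ->
  (n`_[pred p | p <= y] = \prod_(0 <= p < y.+1) p ^ logn p n)%N.
Proof.
move=> n0; rewrite (@widen_partn (n + y)) ?leq_addr //.
by rewrite [RHS](@big_nat_widen _ _ _ _ _ (n + y).+1) ?ltnS ?leq_addl.
Qed.

(** * Prime factors of polynomial values on a block *)

Section Block.

Variables (F : {poly int}) (D m a : nat).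
Hypothesis cF : zcontents F = 1.
Hypothesis szF : (size F <= D.+1)%N.
Hypothesis Dm : (D <= m)%N.

Let nF (k : 'I_m) : nat := `|F.[(a + k)%:Z]|.

Let kap_inj : injective (fun k : 'I_m => (a + k)%:Z).
Proof. by move=> i j [] /addnI /val_inj. Qed.

Let exceptional p : prime p -> exists2 E : {set 'I_m}, #|E| = D & forall k, k \notin E ->
    (logn p (nF k) <= \sum_(t in E) val_int p ((a + k)%:Z - (a + t)%:Z)%R)%N.
Proof.
move=> pr_p; have DT : (D <= #|'I_m|)%N by rewrite card_ord.
exact: (exceptional_val pr_p kap_inj cF szF DT).
Qed.

(** For each prime up to [y], the [D] exceptional indices contribute at most [B] each, and all
    others together at most the [p]-part of [m!] to the power [D]. *)
Lemma smooth_block (B y : nat) :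
  (forall k, 0 < nF k <= B)%N ->
  (\prod_k (nF k)`_[pred p | p <= y]%N <= m`! ^ D * B ^ (D * y.+1))%N.
Proof.
move=> nFB.
rewrite (eq_bigr (fun k => \prod_(0 <= p < y.+1) p ^ logn p (nF k))%N); last first.
  by move=> k _; rewrite partn_leq //; case/andP: (nFB k).
rewrite exchange_big /=.
have -> : (B ^ (D * y.+1) = \prod_(0 <= p < y.+1) B ^ D)%N.
  by rewrite big_const_nat iter_muln_1 subn0 expnM.
apply: leq_trans (_ : \prod_(0 <= p < y.+1) (p ^ logn p (m`! ^ D) * B ^ D) <= _)%N; last first.
  rewrite big_split /= leq_mul2r -partn_leq ?expn_gt0 ?fact_gt0 //.
  by rewrite dvdn_leq ?orbT ?dvdn_part ?expn_gt0 ?fact_gt0.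
apply: leq_prod => p _.
have BD : (0 < B ^ D)%N.
  rewrite expn_gt0; case: posnP => [B0|//]; have [m0|m0] := posnP m.
    by move: Dm; rewrite m0 leqn0.
  by have := nFB (Ordinal m0); rewrite B0 leqn0; case: (nF _).
have [pr_p|npr] := boolP (prime p); last first.
  rewrite big1 => [|k _]; last by rewrite lognE (negbTE npr).
  by rewrite lognE (negbTE npr) /= mul1n.
have [E ED exc] := exceptional pr_p.
rewrite (bigID (mem E)) /= mulnC; apply: leq_mul.
  rewrite -expn_sum leq_exp2l ?prime_gt1 // lognX.
  apply: leq_trans (leq_sum _ (fun k kE => exc k kE)) _.
  rewrite exchange_big /= -ED -sum_nat_const; apply: leq_sum => t _.
  apply: leq_trans (sum_val_dist p t a); rewrite [X in (_ <= X)%N](bigID (mem E)) /=.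
  exact: leq_addl.
rewrite -ED -prod_nat_const; apply: leq_prod => k _.
have /andP [nk0 nkB] := nFB k.
by apply: leq_trans nkB; rewrite dvdn_leq // pfactor_dvdnn.
Qed.

(** If [p] divides the value at a non-exceptional [k], then [k] is congruent modulo [p] to some [t]
    in [E]. The block meets each residue class at most [M] times. *)
Lemma prime_hits (p M : nat) : prime p -> (m <= M * p)%N ->
  (forall k, 0 < nF k)%N ->
  (#|[set k | p %| nF k]%N| <= D * M)%N.
Proof.
move=> pr_p mMp nF0; have [E ED exc] := exceptional pr_p.
apply: leq_trans (_ : #|\bigcup_(t in E) [set k : 'I_m | k == t %[mod p]]| <= _)%N.
  apply/subset_leq_card/subsetP=> k; rewrite inE => pk.
  have [kE|kE] := boolP (k \in E); first by apply/bigcupP; exists k => //; rewrite inE.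
  have : (0 < logn p (nF k))%N by rewrite logn_gt0 mem_primes pr_p nF0.
  move/leq_trans => /(_ _ (exc k kE)); rewrite lt0n sum_nat_eq0 negb_forall.
  case/existsP=> t; rewrite negb_imply -lt0n => /andP [tE vt].
  apply/bigcupP; exists t => //; rewrite inE.
  move: vt; rewrite /val_int logn_gt0 mem_primes => /and3P [_ _].
  have -> : (a + k)%:Z - (a + t)%:Z = k%:Z - t%:Z by lia.
  by move=> h; have := eqz_mod_dvd p k t; rewrite dvdzE h !modz_nat eqz_nat.
apply: leq_trans (_ : \sum_(t in E) #|[set k : 'I_m | k == t %[mod p]]| <= _)%N.
  elim/big_rec2: _ => [|t U c _ IH]; first by rewrite cards0.
  by rewrite (leq_trans (leq_card_setU _ _)) // leq_add2l.
rewrite -ED -sum_nat_const; apply: leq_sum => t _.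
have kM (k : 'I_m) : (k %/ p < M)%N.
  by rewrite ltn_divLR ?prime_gt0 // (leq_trans (ltn_ord k)).
rewrite -[M in (_ <= M)%N]card_ord
  -(card_in_imset (f := fun k => Ordinal (kM k))) ?max_card //.
move=> k k'; rewrite !inE => /eqP kt /eqP k't [ekk']; apply: val_inj => /=.
by rewrite (divn_eq k p) (divn_eq k' p) ekk' kt k't.
Qed.

(** The product of all values is at least [H ^ (D * m)]. Its part from primes up to [y] is bounded
    by [smooth_block]; only indices with a larger prime factor contribute to the rest, each at most
    [B]. *)
Lemma many_large_primes (B y H : nat) :
  (forall k, H ^ D <= nF k <= B)%N -> (0 < H)%N ->
  (H ^ (D * m) <=
   m`! ^ D * B ^ (D * y.+1 + #|[set k | (1 < (nF k)`_([pred p | p <= y]^'))%N]|))%N.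
Proof.
move=> nFB H0; have Hk k : (0 < nF k)%N.
  by case/andP: (nFB k) => + _; apply: leq_trans; rewrite expn_gt0 H0.
apply: leq_trans (_ : \prod_(k < m) nF k <= _)%N.
  rewrite expnM -[X in (_ ^ X)%N]card_ord -prod_nat_const.
  by apply: leq_prod => k _; case/andP: (nFB k).
under eq_bigr => k _ do rewrite -(partnC [pred p | p <= y]%N (Hk k)).
rewrite big_split /= expnD mulnA; apply: leq_mul.
  by apply: smooth_block => k; rewrite Hk; case/andP: (nFB k).
rewrite (bigID (mem [set k | (1 < (nF k)`_([pred p | p <= y]^'))%N])) /=.
rewrite [X in (_ * X <= _)%N]big1 ?muln1 => [|k]; last first.
  by rewrite inE -leqNgt => h; apply/eqP; rewrite eqn_leq h part_gt0.
rewrite -prod_nat_const; apply: leq_prod => k _.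
case/andP: (nFB k) => _; apply: leq_trans; rewrite dvdn_leq ?dvdn_part //.
Qed.

End Block.

(** Pick [k] in [J] and [p] hitting it, discard everything [p] hits, and repeat. In a subset of the
    chosen elements, the one picked earliest is the only one hit by its [p]. *)
Lemma greedy_triangular (T : finType) (hit : nat -> T -> bool) (Q : pred nat)
    (L : nat) (J : {set T}) :
  (forall k, k \in J -> exists2 p, Q p & hit p k) ->
  (forall p, Q p -> #|[set k | hit p k]| <= L)%N ->
  exists A : {set T}, [/\ A \subset J, (#|J| <= #|A| * L)%N &
    forall A' : {set T}, A' \subset A -> A' != set0 ->
      exists k p, [/\ k \in A', Q p, hit p k & forall j, j \in A' -> j != k -> ~~ hit p j]].
Proof.
move=> + QL; have [n] := ubnP #|J|; elim: n J => // n IH J ltn hitJ.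
have [->|/set0Pn [k kJ]] := eqVneq J set0.
  exists set0; split=> //; first by rewrite cards0.
  by move=> A'; rewrite subset0 => /eqP ->; rewrite eqxx.
have [p Qp hp] := hitJ k kJ.
pose J1 := J :\: [set j | hit p j].
have [|j|A [AJ sA tri]] := IH J1.
- apply: leq_trans (_ : #|J| <= n)%N => //; apply: proper_card.
  apply/properP; split; first exact: subsetDl.
  by exists k => //; rewrite !inE hp.
- by rewrite inE => /andP [_ /hitJ].
have kA : k \notin A by apply/negP => /(subsetP AJ); rewrite !inE hp.
exists (k |: A); split.
- rewrite subUset sub1set kJ (subset_trans AJ) //; exact: subsetDl.
- rewrite cardsU1 kA mulSn -(cardsID [set j | hit p j] J) leq_add //.
  by rewrite (leq_trans _ (QL p Qp)) // subset_leq_card // subsetIr.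
move=> A' sA' A'0; have [kA'|kA'] := boolP (k \in A').
  exists k, p; split=> // j /(subsetP sA'); rewrite !inE => /orP [-> //|jA _].
  by have := subsetP AJ _ jA; rewrite !inE => /andP [].
apply: tri => //; apply/subsetP=> j jA'; have := subsetP sA' _ jA'.
rewrite !inE => /orP [/eqP ej|//]; by rewrite -ej jA' in kA'.
Qed.

(** * Independent terms *)

(** Apply the triangular property to the set where [f] and [g] differ: valuations at the resulting
    [p] leave only the term at [k], forcing [f k = g k]. *)
Lemma triangular_exponents (N : nat) (v : 'I_N -> nat) (A : {set 'I_N}) (Q : pred nat)
    (f g : 'I_N -> nat) :
  {subset Q <= prime} -> (forall k, k \in A -> 0 < v k)%N ->
  (forall k, k \notin A -> f k = 0%N /\ g k = 0%N) ->
  (forall A' : {set 'I_N}, A' \subset A -> A' != set0 ->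
     exists k p, [/\ k \in A', Q p, p %| v k &
       forall j, j \in A' -> j != k -> ~~ (p %| v j)]%N) ->
  (\prod_k v k ^ f k = \prod_k v k ^ g k)%N -> f =1 g.
Proof.
move=> Qp v0 out tri eq_fg k0; apply/eqP/negPn/negP=> ne.
pose A' := [set k in A | f k != g k].
have [||k [p [kA' Qpp pk onlyk]]] := tri A'.
- by apply/subsetP=> k; rewrite inE => /andP [].
- apply/set0Pn; exists k0; rewrite inE ne andbT; apply: contraNT ne => /out [-> ->] //.
have logE (h : 'I_N -> nat) : (forall j, j \notin A -> h j = 0%N) ->
    logn p (\prod_k v k ^ h k)%N = (\sum_k h k * logn p (v k))%N.
  move=> hout.
  suff [] : (0 < \prod_k v k ^ h k)%N /\
      logn p (\prod_k v k ^ h k)%N = (\sum_k h k * logn p (v k))%N by [].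
  elim/big_rec2: _ => [|j s P _ [P0 IH]]; first by rewrite logn1.
  have vj : (0 < v j ^ h j)%N.
    by rewrite expn_gt0; have [/v0 ->|/hout ->] := boolP (j \in A); rewrite ?orbT.
  by rewrite muln_gt0 vj P0 lognM // lognX IH.
move: (congr1 (logn p) eq_fg).
rewrite !logE => [|j /out []|j /out []] //.
rewrite (bigD1 k) //= [RHS](bigD1 k) //=.
have -> : (\sum_(i < N | i != k) f i * logn p (v i) =
    \sum_(i < N | i != k) g i * logn p (v i))%N.
  apply: eq_bigr => j jk; have [jA'|] := boolP (j \in A').
    by rewrite lognE (negbTE (onlyk j jA' jk)) !andbF !muln0.
  rewrite inE negb_and negbK => /orP [/out [-> ->] // | /eqP -> //].
have /andP [kA nek] : (k \in A) && (f k != g k) by move: kA'; rewrite inE.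
move/eqP; rewrite eqn_add2r eqn_mul2r (negbTE nek) orbF eqn0Ngt.
by rewrite logn_gt0 mem_primes v0 // pk !andbT => /negP []; exact: (Qp p Qpp).
Qed.

Lemma split_int_poly (K : numClosedFieldType) (F : {poly int}) :
  F != 0 -> exists (c : int) (rs : seq K),
    [/\ c != 0, size F = (size rs).+1 &
        map_poly intr F = c%:~R *: \prod_(w <- rs) ('X - w%:P)].
Proof.
move=> F0; have [rs E] := closed_field_poly_normal (map_poly (intr : int -> K) F).
have sz : size (map_poly (intr : int -> K) F) = size F.
  by rewrite size_map_inj_poly // => x y /eqP; rewrite eqr_int => /eqP.
have lc : lead_coef (map_poly (intr : int -> K) F) = (lead_coef F)%:~R.
  by rewrite lead_coef_map_inj // => x y /eqP; rewrite eqr_int => /eqP.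
exists (lead_coef F), rs; split; rewrite ?lead_coef_eq0 //; last by rewrite -lc.
by rewrite -sz E lc size_scale ?size_prod_XsubC // intr_eq0 lead_coef_eq0.
Qed.

Lemma split_horner (K : numClosedFieldType) (F : {poly int}) c (rs : seq K) (x : int) :
  map_poly intr F = c%:~R *: \prod_(w <- rs) ('X - w%:P) ->
  F.[x]%:~R = c%:~R * \prod_(w <- rs) (x%:~R - w).
Proof.
move=> E; rewrite -horner_map /= E hornerZ horner_prod; congr (_ * _).
by apply: eq_bigr => w _; rewrite hornerXsubC.
Qed.

(* Taking norms: a relation at [z] holds at every conjugate of [z]. *)
Lemma relation_norm (K : numClosedFieldType) (z : K) (N S : nat)
    (F : {poly int}) (f g : 'I_N -> nat) :
  zcontents F = 1 ->
  (forall P : {poly int}, root (map_poly intr P) z -> exists Q, P = F * Q) ->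
  (\sum_k f k = S)%N -> (\sum_k g k = S)%N -> shift_prod z f = shift_prod z g ->
  (\prod_(k < N) `|F.[k%:Z]| ^ f k = \prod_(k < N) `|F.[k%:Z]| ^ g k)%N.
Proof.
move=> cF dvdF Sf Sg fg.
have F0 : F != 0 by apply/eqP => F0; move: cF; rewrite F0 zcontents0.
have [c [rs [c0 szF EF]]] := split_int_poly K F0.
have [|Q EQ] := dvdF (rel_poly f g); first by rewrite rootE rel_poly_horner fg subrr.
have fgw w : w \in rs -> shift_prod w f = shift_prod w g.
  move=> wrs; apply/eqP; rewrite -subr_eq0 -rel_poly_horner EQ rmorphM /= hornerM EF.
  rewrite hornerZ horner_prod (big_rem w) //= hornerXsubC subrr.
  by rewrite mul0r mulr0 mul0r.
(* Homogeneity enters here: the leading coefficient contributes the same factor, its absolute value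
   to the power [S], for [f] and for [g]. *)
have prodE (h : 'I_N -> nat) : (\sum_k h k = S)%N ->
    (\prod_(k < N) `|F.[k%:Z]| ^ h k)%N%:R =
    `|c%:~R| ^+ S * \prod_(w <- rs) `|shift_prod w h| :> K.
  move=> <-; rewrite natr_prod -prodrXr.
  under eq_bigr => k _.
    rewrite natrX -[_%:R]/((Posz `|F.[k%:Z]|%N)%:~R)
      abszE intr_norm (split_horner _ EF) normrM.
    rewrite exprMn normr_prod -prodrXl.
  over.
  rewrite big_split /=; congr (_ * _); rewrite exchange_big /=; apply: eq_bigr => w _.
  rewrite /shift_prod normr_prod; apply: eq_bigr => k _.
  by rewrite normrX distrC.
apply/eqP; rewrite -(eqr_nat K) !prodE //; apply/eqP; congr (_ * _).
by rewrite !big_seq; apply: eq_bigr => w /fgw ->.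
Qed.

Lemma leq_fact_exp n : (n`! <= n ^ n)%N.
Proof.
have h j : (j <= n -> j`! <= n ^ j)%N.
  elim: j => // j IH jn; rewrite factS expnS leq_mul //; exact/IH/ltnW.
exact: h.
Qed.

(** This compares exponents of [M] in the bound of [many_large_primes], with [m!] replaced by
    [m ^ m]. As [4 * E <= M], the term [E * (D * y.+1)] takes up at most half of [D * m]. *)
Lemma block_arith (m M y D E e r : nat) :
  m = (M * y)%N -> (0 < D)%N -> (0 < y)%N -> (4 * E <= M)%N ->
  (e.+2 * (D * m) <= e.+1 * (m * D) + E * (D * y.+1 + r))%N ->
  (m <= 2 * E * r)%N.
Proof.
move=> -> D0 y0 EM.
have -> : (e.+2 * (D * (M * y)) = e.+1 * (M * y * D) + D * (M * y))%N by ring.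
rewrite leq_add2l => h.
have h1 : (4 * E * (D * y) <= M * (D * y))%N by rewrite leq_mul2r EM orbT.
have h2 : (E * (D * y.+1) <= 2 * (E * (D * y)))%N.
  have -> : (2 * (E * (D * y)) = E * (D * (2 * y)))%N by ring.
  by rewrite !leq_mul2l mul2n -addnn -addn1 leq_add2l y0 !orbT.
have h3 : (M * y <= D * (M * y))%N by rewrite leq_pmull.
by move: h h1 h2 h3; rewrite mulnDr; clear; lia.
Qed.

(* [m = M ^ (e + 1)] is the length of the block, [M ^ (e + 2)] its distance to the
   conjugates of [z], and primes are large when they exceed [y = M ^ e]. *)
Lemma large_block (F : {poly int}) (D S M e E a : nat) :
  zcontents F = 1 -> (size F <= D.+1)%N -> (0 < D <= S)%N -> (S <= M)%N ->
  (1 < M)%N -> (4 * E <= M)%N ->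
  (forall k, a <= k < a + M ^ e.+1 -> (M ^ e.+2) ^ D <= `|F.[k%:Z]| <= M ^ E)%N ->
  exists A : {set 'I_(M ^ e.+1)}, (M ^ e <= 2 * E * S * #|A|)%N /\
    forall A' : {set 'I_(M ^ e.+1)}, A' \subset A -> A' != set0 ->
      exists k p, [/\ k \in A', prime p, p %| `|F.[(a + k)%:Z]| &
        forall j, j \in A' -> j != k -> ~~ (p %| `|F.[(a + j)%:Z]|)]%N.
Proof.
move=> cF szF /andP [D0 DS] SM M1 EM Fbd.
set m := (M ^ e.+1)%N in Fbd *; set y := (M ^ e)%N.
have M0 : (0 < M)%N by apply: ltnW.
have y0 : (0 < y)%N by rewrite expn_gt0 M0.
have mE : m = (M * y)%N by rewrite /m expnS.
have Dm : (D <= m)%N.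
  by rewrite mE (leq_trans DS) // (leq_trans SM) // leq_pmulr.
have nFbd (k : 'I_m) : ((M ^ e.+2) ^ D <= `|F.[(a + k)%:Z]| <= M ^ E)%N.
  by apply: Fbd; rewrite leq_addr ltn_add2l ltn_ord.
have H0 : (0 < M ^ e.+2)%N by rewrite expn_gt0 M0.
have nF0 (k : 'I_m) : (0 < `|F.[(a + k)%:Z]|)%N.
  by case/andP: (nFbd k) => + _; apply: leq_trans; rewrite expn_gt0 H0.
have := many_large_primes cF szF Dm y nFbd H0.
set J := [set k | _].
have J2 : (M ^ (e.+2 * (D * m)) <= M ^ (e.+1 * (m * D) + E * (D * y.+1 + #|J|)))%N ->
    (m <= 2 * E * #|J|)%N.
  by rewrite leq_exp2l //; apply: block_arith mE _ _ _.
rewrite -!expnM => h.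
have {h J2} mJ : (m <= 2 * E * #|J|)%N.
  apply: J2; apply: leq_trans h _; rewrite expnD leq_mul2r; apply/orP; right.
  rewrite expnM; apply: leq_trans (_ : (m ^ m) ^ D <= _)%N.
    by rewrite leq_exp2r // leq_fact_exp.
  by rewrite /m -!expnM mulnA.
pose hit p (k : 'I_m) := (p %| `|F.[(a + k)%:Z]|)%N.
(* A prime [p > y] divides at most [D * M] of the values, since [m = M * y <= M * p]. *)
have [k kJ|p /andP [pr_p yp]|A [AJ JA tri]] :=
    @greedy_triangular _ hit (fun p => prime p && (y < p)%N) (D * M) J.
- move: kJ; rewrite inE => big; set n2 := (_`_ _)%N in big.
  have pr := pdiv_prime big; exists (pdiv n2).
    rewrite pr ltnNge; have : [pred p | (p <= y)%N]^'.-nat n2 by apply: part_pnat.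
    by move/(pnatP _ (ltnW big))/(_ _ pr (pdiv_dvd _)).
  exact: dvdn_trans (pdiv_dvd _) (dvdn_part _ _).
- apply: prime_hits => //; rewrite mE leq_mul2l ltnW ?orbT //.
exists A; split.
  rewrite -(leq_pmul2l M0) -mE; apply: leq_trans mJ _.
  apply: leq_trans (leq_mul (leqnn (2 * E)) JA) _.
  have -> : (M * (2 * E * S * #|A|) = 2 * E * (#|A| * (S * M)))%N by ring.
  by rewrite !leq_mul2l leq_mul2r DS !orbT.
move=> A' sA A'0; have [k [p [kA' /andP [pr_p _] pk only]]] := tri A' sA A'0.
by exists k, p.
Qed.

(** A nontrivial relation makes [z] algebraic, so [large_block] applies to its minimal polynomial.
    The exponent [E] is such that [2 * N ^ S <= M ^ E], and [3 * S.+1 <= M] leaves room in [0, N)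
    for [S.+1] blocks with their gaps. *)
Lemma large_rel_free (K : numClosedFieldType) (z : K) (N S M e : nat) :
  let E := ((e + 3) * 2 * S).+1 in
  (S <= M)%N -> (0 < S)%N -> (3 * S.+1 <= M)%N -> (4 * E <= M)%N ->
  (M ^ (e + 3) <= N <= M ^ ((e + 3) * 2))%N ->
  let A0 := [set k : 'I_N | z != (k : nat)%:R] in
  ~ rel_free A0 z S ->
  exists A : {set 'I_N}, [/\ A \subset A0, rel_free A z S & (M ^ e <= 2 * E * S * #|A|)%N].
Proof.
move=> E SM S0 M3 EM /andP [MN NM] A0 nfree.
have M1 : (1 < M)%N by apply: leq_trans M3; rewrite mulnS.
have M0 : (0 < M)%N by apply: ltnW.
have [f [g [nfg Sf Sg fg]]] : exists f g : 'I_N -> nat,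
    [/\ ~ f =1 g, (\sum_k f k = S)%N, (\sum_k g k = S)%N & shift_prod z f = shift_prod z g].
  apply: NNPP => no; apply: nfree => f g _ Sf Sg fg; apply: NNPP => nfg.
  by apply: no; exists f, g.
set G := rel_poly f g.
have G0 : G != 0 := rel_poly_neq0 nfg.
have rG : root (map_poly intr G) z by rewrite rootE rel_poly_horner fg subrr.
have [F [cF rF dvdF]] := min_int_poly G0 rG.
have [Q GQ] := dvdF G rG.
have F0 : F != 0 by apply/eqP => F0; move: cF; rewrite F0 zcontents0.
have Q0 : Q != 0 by apply: contraNneq G0 => Q0; rewrite GQ Q0 mulr0.
have [c [rs [c0 szF EF]]] := split_int_poly K F0.
have [d [ws [d0 szG EG]]] := split_int_poly K G0.
have szGS : (size ws <= S)%N by rewrite -ltnS -szG size_rel_poly.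
have rsS : (0 < size rs <= S)%N.
  apply/andP; split.
    rewrite lt0n size_eq0; apply: contraTneq rF => rs0.
    by rewrite rootE EF rs0 big_nil hornerZ hornerC mulr1 intr_eq0.
  apply: leq_trans szGS; rewrite -ltnS -szF -szG GQ size_mul //.
  by rewrite -subn1 -addnBA ?leq_addr // lt0n size_poly_eq0.
have [a aN avoid] : exists2 a, (a + M ^ e.+1 <= N)%N & forall k : nat,
    (a <= k < a + M ^ e.+1)%N -> forall w, w \in ws -> ((M ^ e.+2)%:R <= `|k%:R - w|)%R.
  apply: block_avoiding; apply: leq_trans MN.
  apply: leq_trans (_ : S.+1 * (3 * M ^ e.+2) <= _)%N.
    apply: leq_mul => //; rewrite (mulSn 2) mul2n leq_add2r.
    by rewrite leq_exp2l.
  rewrite mulnA addn3 (expnS _ e.+2) leq_mul2r; apply/orP; right.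
  by rewrite mulnC.
have rsws w : w \in rs -> w \in ws.
  move=> wrs; have : root (map_poly intr G) w.
    rewrite GQ rmorphM /= rootM EF rootE hornerZ horner_prod (big_rem w) //=.
    by rewrite hornerXsubC subrr mul0r mulr0 eqxx.
  by rewrite EG rootZ ?intr_eq0 // root_prod_XsubC.
(* Below: [c] has absolute value at least 1 and each root is at distance at least [M ^ e.+2]. Above:
   [F.[k]] divides [G.[k]], which is nonzero because the block avoids all roots of [G], not only
   those of [F]. *)
have Fbd k : (a <= k < a + M ^ e.+1)%N ->
    ((M ^ e.+2) ^ size rs <= `|F.[k%:Z]| <= M ^ E)%N.
  move=> kI; have kN : (k < N)%N by apply: leq_trans aN; case/andP: kI.
  have H0 : (0 < M ^ e.+2)%N by rewrite expn_gt0 M0.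
  apply/andP; split.
    rewrite -(ler_nat K) -[X in _ <= X]/((Posz `|F.[k%:Z]|%N)%:~R)
      abszE intr_norm (split_horner _ EF).
    rewrite normrM normr_prod natrX -[X in X <= _]mul1r.
    apply: ler_pM; rewrite ?exprn_ge0 ?ler0n ?ler01 //.
      by rewrite -intr_norm -[1]/(1%:~R) ler_int; move: c0; clear; lia.
    rewrite -[X in _ ^+ X]count_predT -sum1_count -prodrXr.
    rewrite !big_seq; apply: ler_prod => w wrs; rewrite expr1 ler0n /=.
    by apply: avoid => //; apply: rsws.
  have Gk : (0 < `|G.[k%:Z]|)%N.
    rewrite absz_gt0; apply/negP => Gk.
    have : root (map_poly intr G) (k%:R : K).
      by rewrite rootE -[k%:R]/((Posz k)%:~R) horner_map (eqP Gk) /=.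
    rewrite EG rootZ ?intr_eq0 // root_prod_XsubC => /(avoid k kI).
    by rewrite subrr normr0 lern0 -leqn0 leqNgt H0.
  apply: leq_trans (_ : `|G.[k%:Z]| <= _)%N.
    by apply: dvdn_leq => //; rewrite GQ hornerM abszM dvdn_mulr.
  apply: leq_trans (rel_poly_bound Sf Sg kN) _.
  rewrite /E expnS leq_mul // expnM leq_exp2r //.
have szF' : (size F <= (size rs).+1)%N by rewrite szF.
have [A [cardA triA]] := large_block cF szF' rsS SM M1 EM Fbd.
have lt_aN (i : 'I_(M ^ e.+1)) : (a + i < N)%N.
  by apply: leq_trans aN; rewrite ltn_add2l ltn_ord.
pose inj i := Ordinal (lt_aN i).
have inj_inj : injective inj by move=> i j [] /addnI /val_inj.
have F0' k : k \in inj @: A -> (0 < `|F.[(k : nat)%:Z]|)%N.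
  case/imsetP=> i _ ->;
  have /andP [+ _] := Fbd (a + i)%N (ltac:(by rewrite leq_addr ltn_add2l ltn_ord)).
  by apply: leq_trans; rewrite !expn_gt0 M0.
exists (inj @: A); split; last by rewrite card_imset.
  apply/subsetP=> k /F0'; rewrite inE; apply: contraL => /eqP zk.
  rewrite -leqNgt leqn0 absz_eq0 -(intr_eq0 K) -horner_map /=.
  by move: rF; rewrite zk rootE.
move=> f1 g1 out S1 S2 fg1.
apply: (@triangular_exponents _ (fun k : 'I_N => `|F.[(k : nat)%:Z]|%N) (inj @: A)
  prime) => //.
  move=> A' sA' A'0.
  have A'E : A' = inj @: (inj @^-1: A').
    apply/setP=> k; apply/idP/imsetP => [kA'|[i + ->]]; last by rewrite inE.
    have /imsetP [i _ ki] := subsetP sA' _ kA'; exists i => //.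
    by rewrite inE -ki.
  have [||i [p [iA' pr_p pi only]]] := triA (inj @^-1: A').
  - apply/subsetP=> i; rewrite inE => /(subsetP sA') /imsetP [j jA /inj_inj ->] //.
  - by apply: contraNneq A'0 => e0; rewrite A'E e0 imset0.
  exists (inj i), p; split=> //; first by move: iA'; rewrite inE.
  move=> j jA' ne; have /imsetP [j' _ ej] := subsetP sA' _ jA'; rewrite ej in jA' ne *.
  apply: only; rewrite ?inE //; by apply: contraNneq ne => ->.
exact: relation_norm cF dvdF S1 S2 fg1.
Qed.

(** * The bound *)

Section NatBound.

Local Open Scope nat_scope.

Lemma rel_free_card (K : fieldType) (n N : nat) (l r : 'I_N -> 'I_n)
    (z : K) (bl br : 'I_n -> K) (A : {set 'I_N}) (S X : nat) :
  (forall k, k \in A -> bl (l k) * br (r k) = z - (k : nat)%:R)%R ->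
  (forall k, k \in A -> z != (k : nat)%:R)%R ->
  ~~ odd S -> 0 < S -> 0 < X -> n <= X ^ S -> rel_free A z S ->
  #|A| <= 6 * S * (n * X).
Proof.
move=> edgeE znz evS S0 X0 nX free.
(* With [d = S * X + S + 1], [(d - S) ^ S] exceeds [(X * S) ^ S], which is at least [n * S ^ S]. *)
apply: leq_trans (_ : n.*2 * (S * X + S).+1 <= _).
  rewrite leqNgt; apply/negP => /(rel_free_min_degree edgeE znz evS free).
  rewrite leqNgt => /negP; apply; apply: leq_ltn_trans (_ : (X * S) ^ S < _).
    by rewrite expnMn leq_mul2r nX orbT.
  by rewrite ltn_exp2r // -addSn addnK mulnC.
have -> : 6 * S * (n * X) = n.*2 * (3 * (S * X)) by rewrite -mul2n; ring.
rewrite leq_mul2l; apply/orP; right.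
have : S <= S * X by rewrite leq_pmulr.
by move: S0; clear; lia.
Qed.

Lemma nat_root (q N : nat) : 0 < q -> exists M, M ^ q <= N < M.+1 ^ q.
Proof.
move=> q0; elim: N => [|N [M /andP [MN NM]]]; first by exists 0; rewrite exp0n // exp1n.
have [le | lt] := leqP (M.+1 ^ q) N.+1.
  by exists M.+1; rewrite le (leq_ltn_trans NM) // ltn_exp2r.
by exists M; rewrite lt (leq_trans MN).
Qed.

Lemma nat_root_up (q n : nat) : 0 < q -> 0 < n ->
  exists X, [/\ 0 < X, n <= X ^ q & X ^ q <= 2 ^ q * n].
Proof.
case: n => // n q0 _; have [M /andP [Mn nM]] := nat_root n q0.
exists M.+1; split=> //; have [->|M0] := posnP M.
  by rewrite exp1n muln_gt0 expn_gt0.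
apply: leq_trans (_ : 2 ^ q * M ^ q <= _); last by rewrite leq_mul2l (leq_trans Mn) ?orbT.
by rewrite -expnMn leq_exp2r // mul2n -addnn -addn1 leq_add2l.
Qed.

(** Up to constants, a relation-free set has at most [n ^ ((j + 1) / j)] elements, while one with
    [N ^ (j / (j + 1))] elements exists; comparing the two gives the exponent
    [((j + 1) / j) ^ 2]. *)
Theorem shifted_products_bound (K : numClosedFieldType) (j : nat) : 0 < j -> ~~ odd j ->
  exists C, 0 < C /\ forall (n N : nat) (z : K) (l r : 'I_N -> 'I_n) (bl br : 'I_n -> K),
    0 < n -> (forall k, bl (l k) * br (r k) = z - (k : nat)%:R)%R ->
    N ^ (j * j) <= C * n ^ (j.+1 * j.+1).
Proof.
move=> j0 evj.
(* [M] will be the integer [q]-th root of [N]. [M0] makes it large enough for [large_rel_free],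
   smaller values going into the constant; the two summands of [c] serve the cases with and without
   a relation on [A0]. *)
pose e := 3 * j; pose q := e + 3; pose E := (q * 2 * j).+1.
pose M0 := 3 * j.+1 + 4 * E; pose c := 2 * E * j * (6 * j) + 7 * j.
pose C1 := 2 ^ (3 * j.+1 * j * j) * c ^ (j.+1 * j) * 2 ^ (j * j.+1).
exists (M0 ^ (q * (j * j)) + C1); split.
  by rewrite addn_gt0 expn_gt0 /M0 mulnS.
move=> n N z l r bl br n0 edgeE.
have q0 : 0 < q by rewrite /q addn3.
have [M /andP [MN NM]] := nat_root N q0.
have nn k : 0 < n ^ k by rewrite expn_gt0 n0.
rewrite mulnDl; have [small | large] := ltnP M M0.
  apply: leq_trans (leq_addr _ _).
  apply: leq_trans (leq_pmulr _ (nn _)).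
  rewrite [X in _ <= X]expnM leq_exp2r ?muln_gt0 ?j0 //.
  by apply: leq_trans (ltnW NM) _; rewrite leq_exp2r.
apply: leq_trans (leq_addl _ _).
have [X [X0 nX Xn]] := nat_root_up j0 n0.
have jM : j <= M by apply: leq_trans large; rewrite /M0; clear; lia.
have M3 : 3 * j.+1 <= M by apply: leq_trans large; rewrite leq_addr.
have M4 : 4 * E <= M by apply: leq_trans large; rewrite leq_addl.
have M2 : 1 < M by apply: leq_trans M3; rewrite mulnS.
have MNM : M ^ (e + 3) <= N <= M ^ ((e + 3) * 2).
  rewrite MN /=; apply: leq_trans (ltnW NM) _; rewrite -/q mulnC expnM leq_exp2r //.
  by rewrite expnS expn1; move: M2; clear; nia.
set A0 := [set k : 'I_N | z != (k : nat)%:R]%R.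
(* At most one of the factors [z - k] vanishes. *)
have cardN : N <= #|A0|.+1.
  rewrite -[X in X <= _]card_ord -(cardsC A0) -[X in _ <= X]addn1 leq_add2l.
  rewrite leqNgt; apply/negP=> /card_gt1P [k [k' [+ + /eqP ne]]].
  rewrite !inE !negbK => /eqP -> ; rewrite eqr_nat => /eqP kk'.
  by apply: ne; apply: val_inj.
have free_card (A : {set 'I_N}) : A \subset A0 -> rel_free A z j ->
    #|A| <= 6 * j * (n * X).
  move=> sA; apply: (rel_free_card (l := l) (r := r) (bl := bl) (br := br)) => // k kA.
  by have := subsetP sA k kA; rewrite inE.
have nX0 : 0 < n * X by rewrite muln_gt0 n0.
have key : M ^ e <= c * (n * X).
  have [free | nfree] := classic (rel_free A0 z j).
    apply: leq_trans (_ : N <= _).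
      by apply: leq_trans MN; rewrite leq_exp2l // leq_addr.
    apply: leq_trans cardN _; apply: leq_ltn_trans (free_card A0 (subxx _) free) _.
    by rewrite /c; move: j0 nX0; clear; nia.
  have [A [sA freeA cA]] := large_rel_free jM j0 M3 M4 MNM nfree.
  apply: leq_trans cA _; apply: leq_trans (leq_mul (leqnn _) (free_card A sA freeA)) _.
  by rewrite mulnA leq_mul2r leq_addr orbT.
apply: leq_trans (_ : ((2 * M) ^ q) ^ (j * j) <= _).
  rewrite leq_exp2r ?muln_gt0 ?j0 //; apply: leq_trans (ltnW NM) _; rewrite leq_exp2r //.
  by move: M2; clear; lia.
(* The choice [e = 3 * j] gives [q = 3 * j.+1], hence [q * (j * j) = e * (j.+1 * j)]. *)
have -> : ((2 * M) ^ q) ^ (j * j) = 2 ^ (3 * j.+1 * j * j) * ((M ^ e) ^ (j.+1 * j)).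
  rewrite -expnM expnMn -expnM; congr (2 ^ _ * M ^ _); rewrite /q /e; ring.
apply: leq_trans (_ : 2 ^ (3 * j.+1 * j * j) * (c * (n * X)) ^ (j.+1 * j) <= _).
  by rewrite leq_mul2l leq_exp2r ?muln_gt0 ?j0 // key orbT.
rewrite /C1 -!mulnA leq_mul2l; apply/orP; right.
rewrite expnMn leq_mul2l; apply/orP; right.
have -> : j.+1 * j.+1 = j.+1 * j + j.+1 by ring.
rewrite expnMn expnD mulnCA leq_mul2l; apply/orP; right.
by rewrite [j.+1 * j]mulnC !expnM -expnMn leq_exp2r.
Qed.

End NatBound.

(** * Transfer to the algebraically closed field [complex R] *)

Definition complex_of_C (c : C) : complex R := Complex c.1 c.2.

Lemma complex_of_CM (c d : C) :
  complex_of_C (Cmult c d) = complex_of_C c * complex_of_C d.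
Proof. by []. Qed.

Lemma complex_of_CD (c d : C) :
  complex_of_C (Cplus c d) = complex_of_C c + complex_of_C d.
Proof. by []. Qed.

Lemma complex_of_C_nat (k : nat) : complex_of_C (RtoC (INR k)) = k%:R.
Proof.
elim: k => // k IH; rewrite S_INR RtoC_plus complex_of_CD IH -natr1.
by congr (_ + _).
Qed.

Lemma INR_expn (x k : nat) : INR (expn x k) = pow (INR x) k.
Proof. by elim: k => //= k IH; rewrite expnS mult_INR IH. Qed.

Lemma complex_of_C_eq0 (d : C) : d <> RtoC (IZR 0) -> complex_of_C d != 0.
Proof.
by case: d => x y ne; apply/negP => /eqP [x0 y0]; apply: ne; rewrite x0 y0.
Qed.

(** Dividing [a + k * d = b * b'] by [- d] gives [z - k] with [z = - a / d]; the left vertex carries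
    [b] and the right one [- b' / d]. *)
Lemma AP_in_productset_bound (j : nat) : (0 < j)%N -> ~~ odd j ->
  exists C0, (0 < C0)%N /\ forall (B : list C) (a d : C) (N : nat),
    d <> RtoC (IZR 0) -> prodset_contains_AP B a d N ->
    (N ^ (j * j) <= C0 * length B ^ (j.+1 * j.+1))%N.
Proof.
move=> j0 evj; have [C0 [C0gt0 bound]] := shifted_products_bound (complex R) j0 evj.
exists C0; split=> // B a d N d0 AP.
have [->|N0] := posnP N; first by rewrite exp0n ?muln_gt0 ?j0.
have idx b : In b B -> exists i : 'I_(length B), List.nth i B (RtoC (IZR 0)) = b.
  by case/(In_nth _ _ (RtoC (IZR 0))) => i [/ssrnat.ltP lt <-]; exists (Ordinal lt).
have edge (k : 'I_N) : exists p : 'I_(length B) * 'I_(length B),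
    Cplus a (Cmult (RtoC (INR k)) d) =
    Cmult (List.nth p.1 B (RtoC (IZR 0))) (List.nth p.2 B (RtoC (IZR 0))).
  have [b [b' [/idx [i <-] [/idx [i' <-] ->]]]] := AP k (elimT ssrnat.ltP (ltn_ord k)).
  by exists (i, i').
have [p pE] := fin_all_exists edge.
pose zeta (i : 'I_(length B)) := complex_of_C (List.nth i B (RtoC (IZR 0))).
apply: (bound _ _ (- (complex_of_C a / complex_of_C d))
  (fun k => (p k).1) (fun k => (p k).2) zeta (fun i => - (zeta i / complex_of_C d))).
  by apply: leq_ltn_trans (leq0n _) (ltn_ord (p (Ordinal N0)).1).
have dn := complex_of_C_eq0 d0.
move=> k; have := congr1 complex_of_C (pE k).
rewrite complex_of_CD !complex_of_CM complex_of_C_nat -!/(zeta _) => E.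
by rewrite mulrN mulrA -E mulrDl mulfK // opprD.
Qed.

Close Scope ring_scope.
Open Scope R_scope.

Theorem theorem2 :
  GRH ->
  forall eps : R, (0 < eps) ->
  exists Ceps : R, (0 < Ceps) /\
  forall (B : list C) (n : nat), NoDup B -> length B = n ->
  forall (a d : C) (N : nat), d <> RtoC 0 ->
    prodset_contains_AP B a d N ->
    (INR N <= Ceps * Rpower (INR n) (1 + eps)).
Proof.
move=> _ eps eps0.
(* Then [((j + 1) / j) ^ 2 = 1 + 2 / j + 1 / j ^ 2 <= 1 + 3 / j <= 1 + eps]. *)
have [j [j0 evj je]] : exists j, [/\ (0 < j)%N, ~~ odd j & 3 <= eps * INR j].
  pose t := Z.to_nat (up (3 / eps)); exists (2 * t.+1)%N.
  split=> //; first by rewrite mul2n odd_double.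
  have [up1 _] := archimed (3 / eps).
  have h0 : 0 < 3 / eps by apply: Rdiv_lt_0_compat => //; lra.
  have upt : IZR (up (3 / eps)) <= INR t.
    rewrite INR_IZR_INZ; apply: IZR_le; rewrite /t Z2Nat.id; first exact: Z.le_refl.
    by apply: le_IZR; lra.
  have h1 : 3 / eps <= INR (2 * t.+1).
    by have tpos := pos_INR t; rewrite mult_INR !S_INR /=; lra.
  have := Rmult_le_compat_l eps _ _ (Rlt_le _ _ eps0) h1.
  by have -> : eps * (3 / eps) = 3 by rewrite /Rdiv Rmult_comm Rmult_assoc Rinv_l; lra.
have j1 : 1 <= INR j by apply: (le_INR 1); apply/ssrnat.leP.
have [C0 [C00 bound]] := AP_in_productset_bound j0 evj.
have C0pos : 0 < INR C0 by apply: lt_0_INR; apply/ssrnat.ltP.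
(* This is [C0] to the power [1 / j ^ 2], from taking the [j ^ 2]-th root of the integer bound. *)
exists (exp (ln (INR C0) / (INR j * INR j))); split; first exact: exp_pos.
move=> B _ _ <- a d N d0 AP.
have [->|N0] := posnP N.
  by apply: Rlt_le; apply: Rmult_lt_0_compat; apply: exp_pos.
have n0 : (0 < length B)%N.
  by have [b [_ [+ _]]] := AP 0%N (elimT ssrnat.ltP N0); case: B {AP}.
have := bound B a d N d0 AP; move: {AP}(length B) n0 => n n0.
move/ssrnat.leP/le_INR; rewrite mult_INR !INR_expn => main.
have Npos : 0 < INR N by apply: lt_0_INR; apply/ssrnat.ltP.
have n1 : 1 <= INR n by apply: (le_INR 1); apply/ssrnat.leP.
have npos : 0 < INR n by lra.
have ln0 : 0 <= ln (INR n) by rewrite -ln_1; apply: ln_le; lra.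
have : ln (pow (INR N) (j * j)) <= ln (INR C0 * pow (INR n) (j.+1 * j.+1)).
  by apply: ln_le => //; apply: pow_lt.
rewrite ln_mult ?ln_pow //; last exact: pow_lt.
rewrite !mult_INR !S_INR => lnb.
rewrite /Rpower -exp_plus -{1}(exp_ln (INR N)) //.
apply: Rnot_lt_le => /exp_lt_inv; apply: Rle_not_lt.
have jj : 0 < INR j * INR j by apply: Rmult_lt_0_compat; lra.
apply: (Rmult_le_reg_l (INR j * INR j)) => //.
apply: Rle_trans lnb _.
have clear_div u v w : w <> 0 -> w * (u / w + v) = u + w * v.
  by move=> w0; rewrite Rmult_plus_distr_l /Rdiv (Rmult_comm w)
    Rmult_assoc Rinv_l // Rmult_1_r.
rewrite clear_div; last by lra.
rewrite -Rmult_assoc.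
apply: Rplus_le_compat_l; apply: Rmult_le_compat_r => //.
by nra.
Qed.
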